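(* For $k,n\in\mathbf{N}$ let $h_{k,n}''$ be the number of normalized set systems (repeated edges allowed) with weight $n$ in which every vertex has degree at most $k$, and let $b_n$ be the $n$-th Bell number. For every fixed $k\in\mathbf{N}$ and $n\to\infty$, $$\left(\frac{\log n}{n}\right)^{k-1}\left(\frac{1}{\alpha_k}\right)^n b_n\ \ll\ h_{k,n}''\ \ll\ \left(\frac{1}{\alpha_k}\right)^n b_n ,$$ where $\alpha_k$ is the only root of the polynomial $\sum_{i=1}^k x^i/i!-1$ in $(0,1]$.
   Context: $\mathbf{N}=\{1,2,\dots\}$ and $[m]=\{1,2,\dots,m\}$. A set system $H$ is a finite multiset of nonempty finite subsets of $\mathbf{N}$, called edges (so an edge may occur with multiplicity greater than one). The vertex set is $V(H)=\bigcup_{E\in H}E$, and $H$ is normalized if $V(H)=[m]$ for some $m\in\mathbf{N}$. The degree of a vertex $v\in V(H)$ is the number of edges of $H$ containing $v$, counted with multiplicity. The weight of $H$ is $w(H)=\sum_{E\in H}|E|$, with edges counted with multiplicity. The Bell number $b_n$ is the number of set partitions of $[n]$. $\log$ is the natural logarithm. $f(n)\ll g(n)$ means $f(n)=O(g(n))$ as $n\to\infty$; here the implied constants may depend on the fixed $k$. *)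

(* Defs.v *)
From HB Require Import structures.
From mathcomp Require Import all_boot all_order all_algebra.
From mathcomp Require Import finmap multiset.
From mathcomp Require Import all_classical all_reals all_analysis.

Set Implicit Arguments.
Unset Strict Implicit.
Unset Printing Implicit Defensive.

Import Order.TTheory GRing.Theory Num.Theory.
Import numFieldNormedType.Exports.

Local Open Scope mset_scope.
Local Open Scope classical_set_scope.
Local Open Scope ring_scope.

Definition edge : choiceType := {fset nat}.

(* An element [H] of [{mset edge}] is a finitely supported multiplicity
   function; as a sequence, [H] enumerates its edges with repetitions, so that
   big operators over [E <- H] count multiplicities. *)

(* The vertices are positive integers, whence [0 \notin E]. *)
Definition is_set_system (H : {mset edge}) : Prop :=
  forall E : edge, E \in H -> E != fset0 /\ 0%N \notin E.

Definition vertices (H : {mset edge}) : {fset nat} :=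
  (\bigcup_(E <- H) (E : {fset nat}))%fset.

Definition normalized (H : {mset edge}) : Prop :=
  exists2 m : nat, (0 < m)%N & vertices H = [fset i in iota 1 m]%fset.

Definition degree (H : {mset edge}) (v : nat) : nat :=
  (\sum_(E <- H | v \in (E : {fset nat})) 1)%N.

Definition weight (H : {mset edge}) : nat :=
  (\sum_(E <- H) #|` (E : {fset nat})|)%N.

Definition counted_systems (k n : nat) : set {mset edge} :=
  [set H | [/\ is_set_system H, normalized H, weight H = n &
               forall v, v \in vertices H -> (degree H v <= k)%N]].

(* [fset_set A] is the empty finite set when [A] is infinite;
   this is not the case here. *)
Lemma counted_systems_finite (k n : nat) : finite_set (counted_systems k n).
Proof.
pose X : seq edge := enum_fset (fpowerset [fset i in iota 1 n]%fset).
pose f (l : nat) (t : l.-tuple 'I_(size X).+1) : {mset edge} :=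
  seq_mset [seq nth (fset0 : edge) X (i : nat) | i : 'I_(size X).+1 <- t].
apply: (@sub_finite_set _ _ (\bigcup_(l in [set` iota 0 n.+1]) (@f l @` setT))).
  move=> H [Hs [m _ vH] wH _].
  have VE (E : edge) v : E \in H -> v \in (E : {fset nat}) -> v \in vertices H.
    by move=> EH vE; apply/bigfcupP; exists E; rewrite ?EH.
  have mn : (m <= n)%N.
    have -> : m = #|` vertices H|.
      by rewrite vH card_fseq undup_id ?iota_uniq// size_iota.
    rewrite -wH /vertices /weight.
    elim: (enum_mset H) => [|E s IHs]; first by rewrite !big_nil.
    rewrite !big_cons; apply: leq_trans (leq_add (leqnn _) IHs).
    by rewrite cardfsU leq_subr.
  have sz : (size H <= n)%N.
    rewrite -wH /weight -sum1_size [leqLHS]big_seq [leqRHS]big_seq.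
    by apply: leq_sum => E /Hs[E0 _]; rewrite cardfs_gt0.
  have HX (E : edge) : E \in H -> E \in X.
    move=> EH; rewrite /X fpowersetE; apply/fsubsetP => v vE.
    have : v \in iota 1 m by have := VE _ _ EH vE; rewrite vH !inE.
    suff : v \in iota 1 m -> v \in iota 1 n by move=> /[apply]; rewrite !inE.
    rewrite !mem_iota => /andP[-> /=].
    by move=> /leq_trans; apply; rewrite !add1n ltnS.
  exists (size H).
    suff : size H \in iota 0 n.+1 by [].
    by rewrite mem_iota add0n ltnS.
  exists [tuple of map (fun E => inord (index E X)) (in_tuple H)] => //.
  rewrite /f /= -map_comp -[RHS]seq_mset_id; congr seq_mset.
  rewrite -[RHS]map_id; apply/eq_in_map => E /HX EX /=.
  by rewrite inordK ?nth_index// ltnS index_size.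
apply: bigcup_finite => [|l _]; first exact: finite_seq.
exact/finite_image/finite_finset.
Qed.

Definition card_systems (k n : nat) : nat := #|` fset_set (counted_systems k n)|.

Definition bell (n : nat) : nat :=
  #|[set P : {set {set 'I_n}} | finset.partition P [set: 'I_n]]%SET|.

Definition alpha_poly (R : realType) (k : nat) : {poly R} :=
  (\sum_(1 <= i < k.+1) (i`!%:R)^-1 *: 'X^i) - 1.

(* Main.v *)
Require Import Defs.
From HB Require Import structures.
From mathcomp Require Import all_boot all_order all_algebra zify ring lra.

(* Fix the degrees d of the vertices, with sum n, and let N(d) be the number of
   set systems with these degrees.  Sequences of e possibly empty edges with
   degrees d are plentiful and easy to count: there are prod_v C(e, d v) of them.
   Weighting by 1 / e! and summing over e turns this count into N(d), up to a
   constant factor and up to repeated edges; in the case of n vertices of degree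
   1 it gives Dobinski's formula, b_n being of the order of sum_e e^n / e!.  As
   prod_v d(v)! C(e, d v) is a product of falling factorials it lies between
   (e - k + 1)^n and e^n, so that prod_v d(v)! N(d) is compared with b_n:
   - from above, after removing the repeated edges: a system is a simple one plus
     twice a system of weight c, and the choice of the latter costs a factor
     O(n)^c, while b_(n - 2c) is smaller than b_n by far more than n^(-c);
   - from below, the sum over e of (e - k + 1)^n / e! is that of j^n / (j + k - 1)!,
     and the values j = O(n / ln n) carry at least half of sum_j j^n / j!.
   Finally the sum of prod_v 1 / d(v)! over all compositions d of n with parts at
   most k is of the order of alpha^(-n), by its linear recurrence. *)

Set Implicit Arguments.
Unset Strict Implicit.
Unset Printing Implicit Defensive.

(** * Set systems on a finite vertex set with prescribed degrees *)

Definition family_deg (V : finType) (F : {set {set V}}) (v : V) : nat :=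
  \sum_(S in F) (v \in S).

Definition simple_systems (V : finType) (d : V -> nat) : {set {set {set V}}} :=
  [set F : {set {set V}} | (set0 \notin F) && [forall v, family_deg F v == d v]].

Definition mult_deg (V : finType) (B : nat) (mu : {ffun {set V} -> 'I_B}) (v : V)
    : nat :=
  \sum_(S : {set V}) (v \in S) * mu S.

(** A multiset of edges is encoded by its multiplicities, and the bound [B] makes their type finite.
    No system is lost once [B] exceeds all degrees, since a nonempty edge occurs at most as often as
    the degree of any of its vertices. *)
Definition mult_systems (V : finType) (B : nat) (d : V -> nat)
    : {set {ffun {set V} -> 'I_B}} :=
  [set mu : {ffun {set V} -> 'I_B} |
    (mu set0 == 0 :> nat) && [forall v, mult_deg mu v == d v]].

Definition seq_systems (V : finType) (e : nat) (d : V -> nat)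
    : {set {ffun 'I_e -> {set V}}} :=
  [set t : {ffun 'I_e -> {set V}} | [forall v, \sum_i (v \in t i) == d v]].

(** Transposition: each vertex [v] chooses, independently of the others, the [d v] positions of the
    edges that contain it. *)
Lemma card_seq_systems (V : finType) (e : nat) (d : V -> nat) :
  #|seq_systems e d| = \prod_v 'C(e, d v).
Proof.
pose tr (t : {ffun 'I_e -> {set V}}) := [ffun v : V => [set i | v \in t i]].
have tr_inj : injective tr.
  move=> t u /ffunP tu; apply/ffunP => i; apply/setP => v.
  by move: (tu v); rewrite !ffunE => /setP/(_ i); rewrite !inE.
rewrite -(card_imset _ tr_inj).
have -> : tr @: seq_systems e d
    = [set f in family (fun v => [set A : {set 'I_e} | #|A| == d v])].
  apply/setP => f; rewrite [RHS]inE; apply/imsetP/familyP => [[t + ->] v|fP].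
    rewrite !inE => /forallP/(_ v)/eqP <-.
    rewrite /tr ffunE -sum1_card big_mkcond /=; apply/eqP/eq_bigr => i _.
    by rewrite inE; case: (v \in _).
  exists [ffun i => [set v | i \in f v]].
    rewrite inE; apply/forallP => v; move: (fP v); rewrite inE => /eqP <-.
    rewrite -sum1_card [X in _ == X]big_mkcond /=; apply/eqP/eq_bigr => i _.
    by rewrite ffunE inE; case: (i \in _).
  apply/ffunP => v; rewrite ffunE; apply/setP => i.
  by rewrite !inE ffunE inE.
rewrite cardsE card_family foldrE big_image /=; apply: eq_bigr => v _.
by rewrite card_draws card_ord.
Qed.

(** The [j] distinct edges of a simple system can be listed in j! orders, and the system is
    recovered from such a list as its image. *)
Lemma simple_systems_le_seq (V : finType) (d : V -> nat) (j : nat) :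
  \sum_(F in simple_systems d | #|F| == j) j`! <= #|seq_systems j d|.
Proof.
pose im (t : {ffun 'I_j -> {set V}}) := [set t i | i in 'I_j].
rewrite -sum1_card (partition_big im predT) //= [leqLHS]big_mkcond /=.
apply: leq_sum => F _; case: ifP => // /andP[].
rewrite inE => /andP[_ /forallP dF] /eqP cF.
rewrite -ffactnn -{1}cF -[in X in _ ^_ X](card_ord j) -card_inj_ffuns_on.
rewrite sum1dep_card; apply/subset_leq_card/subsetP => t.
rewrite inE => /andP[/ffun_onP tF /injectiveP tinj].
have imt : im t = F.
  apply/eqP; rewrite eqEcard card_imset // card_ord cF leqnn andbT.
  by apply/subsetP => S /imsetP[i _ ->]; exact: tF.
rewrite !inE imt eqxx andbT; apply/forallP => v; rewrite -(eqP (dF v)).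
by rewrite /family_deg -imt big_imset //= => a b _ _; exact: tinj.
Qed.

Lemma card_simple_system_le (V : finType) (d : V -> nat) (F : {set {set V}}) :
  F \in simple_systems d -> #|F| <= \sum_v d v.
Proof.
rewrite inE => /andP[F0 /forallP dF].
rewrite -(eq_bigr _ (fun v _ => eqP (dF v))) exchange_big -sum1_card /=.
apply: leq_sum => S SF; have : S != set0 by apply: contraNneq F0 => <-.
by move=> /set0Pn[v vS]; rewrite (bigD1 v) //= vS.
Qed.

Definition edge_list (V : finType) (B : nat) (mu : {ffun {set V} -> 'I_B}) :=
  flatten [seq nseq (mu A) A | A : {set V} <- enum {set V}].

Lemma count_edge_list (V : finType) (B : nat) (mu : {ffun {set V} -> 'I_B})
    (a : pred {set V}) :
  count a (edge_list mu) = \sum_S a S * mu S.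
Proof.
rewrite /edge_list count_flatten -map_comp sumnE big_map big_enum /=.
by apply: eq_bigr => S _; rewrite count_nseq.
Qed.

Lemma count_mem_edge_list (V : finType) (B : nat) (mu : {ffun {set V} -> 'I_B})
    (S : {set V}) :
  count_mem S (edge_list mu) = mu S.
Proof.
rewrite count_edge_list (bigD1 S) //= eqxx mul1n big1 ?addn0 // => T /negPf.
by move=> ->.
Qed.

(** Serves to order the positions of the nonempty edges of a sequence so that the edges read there
    follow a given list. *)
Lemma perm_map_lift (T U : eqType) (f : T -> U) (p : seq T) (L : seq U) :
  perm_eq (map f p) L -> exists2 p', perm_eq p' p & map f p' = L.
Proof.
elim: L p => [|y L IH] p pL; first by exists [::] => //; case: p pL => // x p /perm_size.
have /mapP[x xp yE] : y \in map f p by rewrite (perm_mem pL) mem_head.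
have : perm_eq (f x :: map f (rem x p)) (y :: L).
  by apply: perm_trans pL; rewrite perm_sym; exact: perm_map (perm_to_rem xp).
rewrite -yE perm_cons => /IH[p' pp' fp'].
exists (x :: p'); last by rewrite /= fp' yE.
rewrite perm_sym; apply: perm_trans (perm_to_rem xp) _.
by rewrite perm_cons perm_sym.
Qed.

(** A sequence whose nonempty edges form [mu] arises by assigning distinct positions to the entries
    of [edge_list mu]. Repeated edges let several assignments give the same sequence, hence an
    inequality. *)
Lemma seq_systems_le_mult (V : finType) (B e : nat) (d : V -> nat) :
  0 < B -> (forall v, d v < B) ->
  #|seq_systems e d| <=
    \sum_(mu in mult_systems B d) e ^_ (size (edge_list mu)).
Proof.
case: B => // B _ dB.
pose ne (t : {ffun 'I_e -> {set V}}) := [seq A <- codom t | A != set0].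
pose mo t := [ffun S => inord (count_mem S (ne t)) : 'I_B.+1].
have neE t : t \in seq_systems e d -> forall S, mo t S = count_mem S (ne t) :> nat.
  move=> tP S; rewrite ffunE inordK //.
  have [->|/set0Pn[v vS]] := eqVneq S set0.
    rewrite /ne count_filter (eq_count (a2 := pred0)) ?count_pred0 // => x /=.
    by case: eqP.
  move: tP; rewrite inE => /forallP/(_ v)/eqP dv.
  rewrite ltnS; apply: (leq_trans _ (_ : d v <= B)); last by rewrite -ltnS.
  rewrite /ne count_filter codomE count_map -dv.
  rewrite -sum1_count big_enum_cond /= big_mkcond /=; apply: leq_sum => i _.
  by case: ifP => // /andP[/eqP -> _]; rewrite vS.
have neP t : t \in seq_systems e d -> perm_eq (ne t) (edge_list (mo t)).
  by move=> tP; apply/allP => S _ /=; rewrite count_mem_edge_list neE.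
have moP t : t \in seq_systems e d -> mo t \in mult_systems B.+1 d.
  move=> tP; rewrite inE neE // count_filter.
  rewrite (eq_count (a2 := pred0)) ?count_pred0 /=; last by move=> x /=; case: eqP.
  apply/forallP => v; have := tP; rewrite inE => /forallP/(_ v)/eqP <-.
  rewrite /mult_deg -(count_edge_list (mo t) (fun S => v \in S)).
  rewrite -(permP (neP t tP)) count_filter codomE count_map.
  rewrite -sum1_count big_enum_cond /= big_mkcond /=; apply/eqP/eq_bigr => i _.
  by case: (boolP (v \in t i)) => //= vt; case: eqP vt => // ->; rewrite inE.
rewrite -sum1_card (partition_big mo (fun mu => mu \in mult_systems B.+1 d)) //=.
apply: leq_sum => mu _; rewrite sum1dep_card.
pose L := edge_list mu.
(* A position outside [p] has index [size L], for which [nth] returns its default, the empty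
   edge. *)
pose place (p : (size L).-tuple 'I_e) := [ffun i => nth set0 L (index i p)].
rewrite -[e in leqRHS](card_ord e) -card_uniq_tuples.
apply: leq_trans (leq_imset_card place _); apply/subset_leq_card/subsetP => t.
rewrite inE => /andP[tP /eqP tmu]; have := neP t tP; rewrite tmu -/L.
pose q := [seq i <- enum 'I_e | t i != set0].
have -> : ne t = map t q by rewrite /ne codomE filter_map.
move=> /perm_map_lift[p pq pL].
have sp : size p == size L by rewrite -pL size_map.
apply/imsetP; exists (Tuple sp).
  rewrite inE /= (perm_uniq pq) filter_uniq ?enum_uniq // andbT.
  by apply/allP.
apply/ffunP => i; rewrite ffunE /=; have [ip|ip] := boolP (i \in p).
  by rewrite -pL (nth_map i) ?index_mem // nth_index.
rewrite memNindex // nth_default ?(eqP sp) //; apply/eqP; move: ip.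
by rewrite (perm_mem pq) mem_filter mem_enum andbT negbK.
Qed.

Lemma size_edge_list (V : finType) (B : nat) (mu : {ffun {set V} -> 'I_B}) :
  mu set0 = 0 :> nat -> size (edge_list mu) <= \sum_v mult_deg mu v.
Proof.
move=> mu0; rewrite -count_predT count_edge_list exchange_big /=.
apply: leq_sum => S _; rewrite -big_distrl /=.
have [->|/set0Pn[v vS]] := eqVneq S set0; first by rewrite mu0 muln0.
by rewrite leq_mul2r (bigD1 v) //= vS orbT.
Qed.

(** Entries past the end read as [x0], which [a] rejects; lists of different sizes can thus be
    scanned over one common range. *)
Lemma count_nth (T : Type) (x0 : T) (a : pred T) (s : seq T) (c : nat) :
  ~~ a x0 -> size s <= c -> count a s = \sum_(i < c) a (nth x0 s i).
Proof.
move=> a0; elim: s c => [|x s IH] [|c] //= sc.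
- by rewrite big_ord0.
- by rewrite big1 // => i _; rewrite nth_nil (negPf a0).
- by rewrite big_ord_recl /= (IH c).
Qed.

(** Padded with empty edges, the edge list has length [c]. Its incidences form a subset of
    [V * 'I_c] with exactly [c] elements, and this subset determines [mu]. *)
Lemma card_mult_weight (V : finType) (B c : nat) :
  #|[set mu : {ffun {set V} -> 'I_B} |
       (mu set0 == 0 :> nat) && (\sum_v mult_deg mu v == c)]| <= 'C(#|V| * c, c).
Proof.
pose sl (mu : {ffun {set V} -> 'I_B}) : {set V * 'I_c} :=
  [set x : V * 'I_c | x.1 \in nth set0 (edge_list mu) x.2].
rewrite -[c in X in 'C(X, _)]card_ord -card_prod -card_draws -(@card_in_imset _ _ sl).
  apply/subset_leq_card/subsetP => _ /imsetP[mu + ->].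
  rewrite !inE => /andP[/eqP mu0 /eqP wmu].
  have sL := size_edge_list mu0; rewrite wmu in sL.
  rewrite -sum1_card big_mkcond /=; apply/eqP; rewrite -[RHS]wmu.
  rewrite (eq_bigr (fun x : V * 'I_c => (fun v (i : 'I_c) => 
     (v \in nth set0 (edge_list mu) i) : nat) x.1 x.2)); last first.
    by move=> x _; rewrite inE; case: (_ \in _).
  rewrite -(pair_bigA _ (fun v (i : 'I_c) => (v \in nth set0 (edge_list mu) i) : nat)) /=.
  apply: eq_bigr => v _; rewrite /mult_deg.
  rewrite -(count_edge_list mu (fun S => v \in S)).
  by rewrite (count_nth (x0 := set0) _ sL) ?inE.
move=> mu nu; rewrite !inE => /andP[/eqP mu0 /eqP wmu] /andP[/eqP nu0 /eqP wnu] sE.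
have nthE (i : 'I_c) : nth set0 (edge_list mu) i = nth set0 (edge_list nu) i.
  by apply/setP => v; move/setP: sE => /(_ (v, i)); rewrite !inE.
apply/ffunP => S; apply: val_inj => /=.
(* Padding adds copies of [set0], so the multiplicity of [set0] is not read off the padded list but
   taken from the hypotheses. *)
have [->|S0] := eqVneq S set0; first by rewrite mu0 nu0.
have cE (la : {ffun {set V} -> 'I_B}) : la set0 = 0 :> nat ->
    \sum_v mult_deg la v = c ->
    la S = \sum_(i < c) (nth set0 (edge_list la) i == S) :> nat.
  move=> la0 wla; have sL := size_edge_list la0; rewrite wla in sL.
  by rewrite -count_mem_edge_list (count_nth (x0 := set0) _ sL) //= eq_sym.
by rewrite !cE //; apply: eq_bigr => i _; rewrite nthE.
Qed.

(* A multiset is a simple set plus twice a multiset, by parity of multiplicities. *)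
Lemma mult_systems_halve (V : finType) (B : nat) (d : V -> nat) :
  #|mult_systems B d| <=
    \sum_(nu : {ffun {set V} -> 'I_B} | (nu set0 == 0 :> nat) &&
            [forall v, 2 * mult_deg nu v <= d v])
       #|simple_systems (fun v => d v - 2 * mult_deg nu v)|.
Proof.
have half_lt (i : 'I_B) : i./2 < B by case: i => i /=; lia.
pose hf (mu : {ffun {set V} -> 'I_B}) := [ffun S => Ordinal (half_lt (mu S))].
pose od (mu : {ffun {set V} -> 'I_B}) := [set S | odd (mu S)].
have degE mu v : mult_deg mu v = family_deg (od mu) v + 2 * mult_deg (hf mu) v.
  rewrite /mult_deg /family_deg [in RHS]big_mkcond big_distrr -big_split /=.
  apply: eq_bigr => S _; rewrite inE ffunE /= -{1}(odd_double_half (mu S)).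
  by case: (v \in S); case: (odd _); lia.
rewrite -sum1_card (partition_big hf (fun nu => (nu set0 == 0 :> nat) &&
    [forall v, 2 * mult_deg nu v <= d v])) /=; last first.
  move=> mu; rewrite inE => /andP[/eqP mu0 /forallP dmu].
  rewrite ffunE /= mu0 /=; apply/forallP => v.
  by rewrite -(eqP (dmu v)) [leqRHS]degE leq_addl.
apply: leq_sum => nu _; rewrite sum1dep_card -(@card_in_imset _ _ od).
  apply/subset_leq_card/subsetP => _ /imsetP[mu + ->].
  rewrite !inE => /andP[/andP[/eqP mu0 /forallP dmu] /eqP hmu].
  rewrite mu0 /=; apply/forallP => v.
  by rewrite -(eqP (dmu v)) degE hmu addnK.
move=> mu la; rewrite !inE => /andP[_ /eqP hmu] /andP[_ /eqP hla] oE.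
apply/ffunP => S; apply: val_inj => /=.
rewrite -[LHS]odd_double_half -[RHS]odd_double_half.
have /setP/(_ S) := oE; rewrite !inE => ->.
have /ffunP/(_ S) : hf mu = hf la by rewrite hmu hla.
by rewrite !ffunE => /(congr1 val) /= ->.
Qed.

(** Degrees at least 1 mean that the blocks cover [V], degrees at most 1 that they are disjoint. *)
Lemma partition_simple_systems (V : finType) :
  [set P | partition P [set: V]] = simple_systems (fun=> 1).
Proof.
apply/setP => P; rewrite !inE; apply/and3P/andP => [[/eqP cP tP P0]|[P0 /forallP dP]].
  split=> //; apply/forallP => v; have vP : v \in cover P by rewrite cP.
  rewrite /family_deg (bigD1 (pblock P v)) ?pblock_mem //= mem_pblock vP big1 //.
  move=> S /andP[SP]; apply: contra_neq_eq; rewrite eqb0 negbK.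
  by move=> /(def_pblock tP SP).
split=> //.
  apply/eqP/setP => v; rewrite [RHS]inE; apply/bigcupP.
  have [/existsP[S /andP[SP vS]]|] := boolP [exists S in P, v \in S].
    by exists S.
  rewrite negb_exists_in => /forall_inP nS; have := eqP (dP v).
  by rewrite /family_deg big1 // => S /nS /negPf ->.
apply/trivIsetP => S T SP TP ST; apply/pred0P => v /=; apply/negP => /andP[vS vT].
have := eqP (dP v); rewrite /family_deg (bigD1 S) //= (bigD1 T) ?TP 1?eq_sym //=.
by rewrite vS vT.
Qed.

(** A nonempty edge has multiplicity at most 1, the degree of any of its vertices, so [mu] is the
    indicator of its support. *)
Lemma mult_systems_deg1 (V : finType) (B : nat) :
  #|@mult_systems V B (fun=> 1)| <= #|@simple_systems V (fun=> 1)|.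
Proof.
pose supp (mu : {ffun {set V} -> 'I_B}) := [set S | mu S != 0 :> nat].
have mu1 mu : mu \in mult_systems B (fun=> 1) ->
    forall S, mu S = (S \in supp mu) :> nat.
  rewrite inE => /andP[/eqP mu0 /forallP dmu] S; rewrite inE.
  have [->|/set0Pn[v vS]] := eqVneq S set0; first by rewrite mu0.
  have := eqP (dmu v); rewrite /mult_deg (bigD1 S) //= vS mul1n.
  by case: (nat_of_ord _) => // -[].
rewrite -(@card_in_imset _ _ supp).
  apply/subset_leq_card/subsetP => _ /imsetP[mu muP ->].
  have := muP; rewrite !inE => /andP[-> /forallP dmu] /=; apply/forallP => v.
  rewrite -(eqP (dmu v)) /family_deg big_mkcond /=; apply/eqP/eq_bigr => S _.
  by rewrite (mu1 _ muP); case: (_ \in _); case: (_ \in _).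
move=> mu la muP laP sE; apply/ffunP => S; apply: val_inj => /=.
by rewrite mu1 // mu1 // sE.
Qed.

(** * From multisets of edges to multiplicity functions *)

From mathcomp Require Import finmap multiset.
Local Open Scope mset_scope.

Definition edge_of (m : nat) (S : {set 'I_m}) : edge :=
  [fset (nat_of_ord i).+1 | i in S]%fset.

Lemma mem_edge_of (m : nat) (S : {set 'I_m}) (i : 'I_m) :
  (i.+1 \in edge_of S) = (i \in S).
Proof.
apply/imfsetP/idP => [[j /= jS [/val_inj ->]]//|iS]; by exists i.
Qed.

Lemma edge_ofP (m : nat) (S : {set 'I_m}) (v : nat) :
  v \in edge_of S -> exists i : 'I_m, v = i.+1.
Proof. by move=> /imfsetP[i _ ->]; exists i. Qed.

Lemma edge_of_inj (m : nat) : injective (@edge_of m).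
Proof. by move=> S T ST; apply/setP => i; rewrite -!mem_edge_of ST. Qed.

Lemma card_edge_of (m : nat) (S : {set 'I_m}) : #|` edge_of S| = #|S|.
Proof.
rewrite card_imfset /= ?cardE //.
by move=> i j [/val_inj].
Qed.

Lemma edge_of_surj (m : nat) (E : edge) :
  (forall v, v \in (E : {fset nat}) -> 0 < v <= m) ->
  edge_of [set i : 'I_m | i.+1 \in (E : {fset nat})] = E.
Proof.
move=> Em; apply/fsetP => v; apply/idP/idP => [/[dup] /edge_ofP[i ->]|vE].
  by rewrite mem_edge_of inE.
have /andP[v0 vm] := Em v vE.
have vm' : v.-1 < m by lia.
have -> : v = (Ordinal vm').+1 by rewrite /= prednK.
by rewrite mem_edge_of inE /= prednK.
Qed.

Definition system_of (m B : nat) (mu : {ffun {set 'I_m} -> 'I_B}) : {mset edge} :=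
  seq_mset [seq edge_of A | A <- edge_list mu].

Lemma perm_system_of (m B : nat) (mu : {ffun {set 'I_m} -> 'I_B}) :
  perm_eq (system_of mu) [seq edge_of A | A <- edge_list mu].
Proof. exact: perm_eq_seq_mset. Qed.

Lemma system_of_edge (m B : nat) (mu : {ffun {set 'I_m} -> 'I_B}) (S : {set 'I_m}) :
  system_of mu (edge_of S) = mu S.
Proof.
rewrite mset_seqE count_map -count_mem_edge_list; apply: eq_count => T /=.
by rewrite (inj_eq (@edge_of_inj m)).
Qed.

Lemma system_of_inj (m B : nat) : injective (@system_of m B).
Proof.
move=> mu nu mn; apply/ffunP => S; apply: val_inj => /=.
by rewrite -!system_of_edge mn.
Qed.

Lemma mem_edge_list (V : finType) (B : nat) (mu : {ffun {set V} -> 'I_B}) (S : {set V}) :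
  (S \in edge_list mu) = (0 < mu S).
Proof. by rewrite -has_pred1 has_count count_mem_edge_list. Qed.

Lemma degree_system_of (m B : nat) (mu : {ffun {set 'I_m} -> 'I_B}) (i : 'I_m) :
  degree (system_of mu) i.+1 = mult_deg mu i.
Proof.
rewrite /degree (perm_big _ (perm_system_of mu)) /= big_map sum1_count.
rewrite (eq_count (a2 := fun S : {set 'I_m} => i \in S)); last first.
  by move=> S /=; rewrite mem_edge_of.
by rewrite count_edge_list.
Qed.

Lemma degree_system_of0 (m B : nat) (mu : {ffun {set 'I_m} -> 'I_B}) (v : nat) :
  ~~ (0 < v <= m) -> degree (system_of mu) v = 0.
Proof.
move=> vm; rewrite /degree (perm_big _ (perm_system_of mu)) /= big_map sum1_count.
rewrite (eq_count (a2 := pred0)) ?count_pred0 // => S /=.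
by apply: contraNF vm => /edge_ofP[i ->] /=.
Qed.

Lemma weight_system_of (m B : nat) (mu : {ffun {set 'I_m} -> 'I_B}) :
  weight (system_of mu) = \sum_i mult_deg mu i.
Proof.
rewrite /weight (perm_big _ (perm_system_of mu)) /= big_map /mult_deg.
under [RHS]eq_bigr => i _ do rewrite -(count_edge_list mu (fun S => i \in S)).
under [RHS]eq_bigr => i _ do rewrite -sum1_count big_mkcond.
rewrite exchange_big /=; apply: eq_bigr => S _.
by rewrite card_edge_of -sum1_card big_mkcond.
Qed.

Lemma degree_gt0 (H : {mset edge}) (v : nat) : (0 < degree H v) = (v \in vertices H).
Proof.
rewrite /degree sum1_count -has_count; apply/hasP/bigfcupP => [[E EH vE]|[E]].
  by exists E; rewrite ?EH.
by rewrite andbT => EH vE; exists E.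
Qed.

(** Intended for normalized systems, whose vertex set is an initial segment of the positive integers
    and so is determined by its cardinality. *)
Definition degree_seq (H : {mset edge}) : seq nat :=
  [seq degree H v | v <- iota 1 #|` vertices H|].

Lemma card_iota_fset (m : nat) : #|` [fset i in iota 1 m]%fset| = m.
Proof. by rewrite card_fseq undup_id ?iota_uniq // size_iota. Qed.

Lemma in_iota_fset (m v : nat) : (v \in [fset i in iota 1 m]%fset) = (0 < v <= m).
Proof. by rewrite !inE /= mem_iota; lia. Qed.

(** Multiplicities below [k.+1] suffice because no edge occurs more often than the degree of one of
    its vertices. Positivity of the parts makes each of the labels from 1 to [size ds] a vertex, and
    [0 < n] makes the vertex set nonempty. *)
Lemma counted_systemsP (k n : nat) (ds : seq nat) (H : {mset edge}) :
  0 < n -> all (fun i => 0 < i <= k) ds -> sumn ds = n ->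
  counted_systems k n H /\ degree_seq H = ds <->
  exists2 mu, mu \in mult_systems k.+1 (fun i : 'I_(size ds) => nth 0 ds i) &
    system_of mu = H.
Proof.
move=> n0 /allP dsk dsn; set m := size ds.
have dE (i : 'I_m) : nth 0 ds i \in ds by rewrite mem_nth.
split=> [[[Hs [m' m0 vH] wH dH] dsH]|[mu + <-]].
  have mm' : m' = m by rewrite /m -dsH size_map size_iota vH card_iota_fset.
  rewrite {m'}mm' in m0 vH.
  have EV (E : edge) v : E \in H -> v \in (E : {fset nat}) -> 0 < v <= m.
    by move=> EH vE; rewrite -in_iota_fset -vH; apply/bigfcupP; exists E; rewrite ?EH.
  have dnth (i : 'I_m) : nth 0 ds i = degree H i.+1.
    by rewrite -dsH /degree_seq vH card_iota_fset (nth_map 0) ?size_iota // nth_iota.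
  have HS (S : {set 'I_m}) : S != set0 -> H (edge_of S) <= k.
    move=> /set0Pn[i iS]; apply: (@leq_trans (degree H i.+1)).
      rewrite -count_mem_mset /degree sum1_count; apply: sub_count => E /= /eqP ->.
      by rewrite mem_edge_of.
    by apply: dH; rewrite vH in_iota_fset /=.
  have H0 : H (edge_of (set0 : {set 'I_m})) = 0.
    apply/eqP; rewrite mset_eq0; apply/negP => /Hs[/negP + _]; apply.
    by rewrite -cardfs_eq0 card_edge_of cards0.
  pose mu : {ffun {set 'I_m} -> 'I_k.+1} := [ffun S => inord (H (edge_of S))].
  have muE S : mu S = H (edge_of S) :> nat.
    rewrite ffunE inordK // ltnS; have [->|] := eqVneq S set0; first by rewrite H0.
    exact: HS.
  have muH : system_of mu = H.
    apply/msetP => E; have [EH|EH] := boolP (E \in H).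
      by rewrite -(@edge_of_surj m E (EV _ ^~ EH)) system_of_edge muE.
    rewrite (mset_eq0P EH); apply/eqP; rewrite mset_eq0.
    rewrite (perm_mem (perm_system_of mu)); apply/mapP => -[S].
    by rewrite mem_edge_list muE => + ES; rewrite -ES lt0n mset_eq0 EH.
  exists mu => //; rewrite inE muE H0 eqxx /=; apply/forallP => i.
  by rewrite -degree_system_of muH dnth.
rewrite inE => /andP[/eqP mu0 /forallP dmu].
have degE (i : 'I_m) : degree (system_of mu) i.+1 = nth 0 ds i.
  by rewrite degree_system_of; exact/eqP.
have vE : vertices (system_of mu) = [fset i in iota 1 m]%fset.
  apply/fsetP => v; rewrite -degree_gt0 in_iota_fset.
  have [/andP[v0 vm]|vm] := boolP (0 < v <= m); last by rewrite degree_system_of0.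
  have vm' : v.-1 < m by lia.
  have -> : v = (Ordinal vm').+1 by rewrite /= prednK.
  by rewrite degE; case/andP: (dsk _ (dE (Ordinal vm'))).
have dsE : degree_seq (system_of mu) = ds.
  rewrite /degree_seq vE card_iota_fset; apply: (@eq_from_nth _ 0).
    by rewrite size_map size_iota.
  move=> i; rewrite size_map size_iota => im.
  by rewrite (nth_map 0) ?size_iota // nth_iota // add1n (degE (Ordinal im)).
split=> //; split.
- move=> E; rewrite (perm_mem (perm_system_of mu)) => /mapP[S].
  rewrite mem_edge_list => muS ->; split.
    rewrite -cardfs_gt0 card_edge_of card_gt0.
    by apply: contraTneq muS => ->; rewrite mu0.
  by apply/negP => /edge_ofP[].
- exists m => //; rewrite /m; case: (ds) dsn => //= dsn.
  by rewrite -dsn in n0.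
- rewrite weight_system_of -dsn sumnE (big_nth 0) big_mkord.
  by apply: eq_bigr => i _; exact/eqP.
- move=> v; rewrite vE in_iota_fset => /andP[v0 vm].
  have vm' : v.-1 < m by lia.
  have -> : v = (Ordinal vm').+1 by rewrite /= prednK.
  by rewrite degE; case/andP: (dsk _ (dE (Ordinal vm'))).
Qed.

Lemma sumn_degree_seq (H : {mset edge}) (m : nat) :
  vertices H = [fset i in iota 1 m]%fset -> sumn (degree_seq H) = weight H.
Proof.
move=> vH; rewrite /degree_seq vH card_iota_fset sumnE big_map /degree /weight.
under eq_bigr => v _ do rewrite big_mkcond.
rewrite exchange_big /= [LHS]big_seq [RHS]big_seq; apply: eq_bigr => E EH.
rewrite -big_mkcond sum1_count -size_filter; apply: perm_size.
apply: uniq_perm => [||v]; rewrite ?filter_uniq ?iota_uniq ?fset_uniq //.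
rewrite mem_filter; apply: andb_idr => vE.
have : v \in vertices H by apply/bigfcupP; exists E; rewrite ?EH.
by rewrite vH !inE.
Qed.

Lemma degree_seq_parts (k n : nat) (H : {mset edge}) :
  counted_systems k n H ->
  all (fun i => 0 < i <= k) (degree_seq H) /\ sumn (degree_seq H) = n.
Proof.
move=> [_ [m m0 vH] wH dH]; split; last by rewrite (sumn_degree_seq vH).
rewrite /degree_seq vH card_iota_fset all_map; apply/allP => v vm /=.
have vV : v \in vertices H by rewrite vH !inE.
by rewrite degree_gt0 vV dH.
Qed.

Import Order.TTheory GRing.Theory Num.Theory.
Local Open Scope ring_scope.

(** * Truncated Dobinski sums *)

(* Up to the factor e this is Dobinski's functional truncated at [E]; it maps
   the falling factorial [x ^_ j] into [1, 3] as soon as [j < E]. *)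
Definition dobinski (R : realFieldType) (E : nat) (g : nat -> nat) : R :=
  \sum_(e < E) (g e)%:R / e`!%:R.

Lemma le_dobinski (R : realFieldType) (E : nat) (f g : nat -> nat) :
  (forall e, (f e <= g e)%N) -> dobinski R E f <= dobinski R E g.
Proof.
by move=> fg; apply: ler_sum => e _; rewrite ler_wpM2r ?invr_ge0 // ler_nat.
Qed.

Lemma dobinski_ge0 (R : realFieldType) (E : nat) (f : nat -> nat) :
  0 <= dobinski R E f.
Proof. by apply: sumr_ge0 => e _; rewrite divr_ge0. Qed.

Lemma dobinskiZ (R : realFieldType) (E : nat) (a : nat) (f : nat -> nat) :
  dobinski R E (fun e => a * f e)%N = a%:R * dobinski R E f.
Proof. by rewrite mulr_sumr; apply: eq_bigr => e _; rewrite natrM mulrA. Qed.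

Lemma dobinski_sum (R : realFieldType) (I : finType) (P : pred I) (E : nat)
    (f : I -> nat -> nat) :
  dobinski R E (fun e => \sum_(i | P i) f i e)%N = \sum_(i | P i) dobinski R E (f i).
Proof.
rewrite /dobinski exchange_big; apply: eq_bigr => e _ /=.
by rewrite natr_sum mulr_suml.
Qed.

Lemma sum_inv_fact_le3 (R : realFieldType) (E : nat) :
  \sum_(e < E) (e`!%:R : R)^-1 <= 3.
Proof.
case: E => [|E]; first by rewrite big_ord0.
(* Comparison with a geometric series, as (E + 1)! is at least [2 ^ E]; the subtracted remainder
   makes the bound inductive. *)
suff : \sum_(e < E.+1) (e`!%:R : R)^-1 <= 3 - 2 / 2 ^+ E.
  by move=> /le_trans; apply; rewrite gerBl divr_ge0 // exprn_ge0.
elim: E => [|E IH]; first by rewrite big_ord1 fact0 expr0; lra.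
rewrite big_ord_recr /=.
have : (E.+1`!%:R : R)^-1 <= (2 ^+ E)^-1.
  rewrite lef_pV2 ?posrE ?exprn_gt0 ?ltr0n ?fact_gt0 // -natrX ler_nat.
  elim: E {IH} => // E IH; rewrite expnS factS leq_mul //.
rewrite exprS invfM; move: IH; set x := (2 ^+ E)^-1; lra.
Qed.

(** The quotient of [e ^_ j] by e! is 1 / (e - j)! for [j <= e] and 0 otherwise, which leaves a
    partial sum of the exponential series at 1. *)
Lemma dobinski_ffact_le3 (R : realFieldType) (E j : nat) :
  dobinski R E (fun e => e ^_ j) <= 3.
Proof.
suff -> : dobinski R E (fun e => e ^_ j) = \sum_(e < E - j) (e`!%:R)^-1.
  exact: sum_inv_fact_le3.
rewrite /dobinski; elim: E => [|E IH]; first by rewrite sub0n !big_ord0.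
rewrite big_ord_recr /= IH; have [jE|Ej] := leqP j E; last first.
  rewrite ffact_small // mul0r addr0.
  by rewrite (eqP (ltnW Ej : E - j == 0)%N) (eqP (Ej : E.+1 - j == 0)%N).
rewrite subSn // big_ord_recr /= -(ffact_fact jE) natrM invfM mulrA mulfV ?mul1r //.
by rewrite pnatr_eq0 -lt0n ffact_gt0.
Qed.

(** Systems are sorted by their number [j] of edges, which is below [E]. Those with [j] edges yield
    j! sequences each, whence the division by j!. *)
Lemma simple_systems_le_dobinski (R : realFieldType) (V : finType) (d : V -> nat)
    (E : nat) :
  (\sum_v d v < E)%N ->
  #|simple_systems d|%:R <= dobinski R E (fun e => \prod_v 'C(e, d v))%N.
Proof.
move=> dE.
have -> : #|simple_systems d| =
    (\sum_(j < E) \sum_(F in simple_systems d | #|F| == j) 1)%N.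
  have Fj F : F \in simple_systems d -> (#|F| < E)%N.
    by move=> /card_simple_system_le/leq_ltn_trans; apply.
  case: E {dE} Fj => [|E] Fj.
    by rewrite big_ord0; apply: eq_card0 => F; apply/negP => /Fj.
  rewrite -sum1_card (partition_big (fun F : {set {set V}} => inord #|F| : 'I_E.+1) xpredT) //=.
  apply: eq_bigr => j _; apply: eq_bigl => F.
  case FP : (F \in simple_systems d) => //=.
  by rewrite -val_eqE /= inordK ?Fj.
rewrite natr_sum /dobinski; apply: ler_sum => j _.
rewrite ler_pdivlMr ?ltr0n ?fact_gt0 // -natrM ler_nat -card_seq_systems.
apply: leq_trans (simple_systems_le_seq d j).
by rewrite big_distrl /=; apply: leq_sum => F _; rewrite mul1n.
Qed.

(** Each [mu] contributes a falling factorial to the count of sequences, and [dobinski] of a falling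
    factorial is at most 3. *)
Lemma dobinski_le_mult_systems (R : realFieldType) (V : finType) (B : nat)
    (d : V -> nat) (E : nat) :
  (0 < B)%N -> (forall v, d v < B)%N ->
  dobinski R E (fun e => \prod_v 'C(e, d v))%N <= 3 * #|mult_systems B d|%:R.
Proof.
move=> B0 dB; pose g e := (\sum_(mu in mult_systems B d) e ^_ size (edge_list mu))%N.
apply: le_trans (_ : _ <= dobinski R E g) _.
  by apply: le_dobinski => e; rewrite -card_seq_systems seq_systems_le_mult.
rewrite dobinski_sum -sum1_card natr_sum mulr_sumr; apply: ler_sum => mu _.
by rewrite mulr1 dobinski_ffact_le3.
Qed.

(** With all degrees 1 the product of binomials is [e ^ #|V|]. This lemma and the next are the two
    halves of Dobinski's formula, up to constant factors. *)
Lemma partitions_le_dobinski (R : realFieldType) (V : finType) (E : nat) :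
  (#|V| < E)%N ->
  #|[set P | partition P [set: V]]|%:R <= dobinski R E (fun e => e ^ #|V|)%N.
Proof.
move=> VE; rewrite partition_simple_systems.
apply: le_trans (simple_systems_le_dobinski R (E := E) _) _.
  by rewrite sum1_card.
by apply: le_dobinski => e; under eq_bigr do rewrite bin1; rewrite prod_nat_const.
Qed.

Lemma dobinski_le_partitions (R : realFieldType) (V : finType) (E : nat) :
  dobinski R E (fun e => e ^ #|V|)%N <= 3 * #|[set P | partition P [set: V]]|%:R.
Proof.
rewrite partition_simple_systems.
apply: le_trans (_ : _ <= 3 * #|@mult_systems V 2 (fun=> 1%N)|%:R) _; last first.
  by rewrite ler_pM2l // ler_nat mult_systems_deg1.
apply: le_trans (dobinski_le_mult_systems R E _ _) => //.
by apply: le_dobinski => e; under eq_bigr do rewrite bin1; rewrite prod_nat_const.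
Qed.

(** * Upper and lower bounds for prescribed degrees *)

Lemma prod_fact_bin (V : finType) (d : V -> nat) (e : nat) :
  ((\prod_v (d v)`!) * \prod_v 'C(e, d v) = \prod_v e ^_ (d v))%N.
Proof. by rewrite -big_split; apply: eq_bigr => v _ /=; rewrite mulnC bin_ffact. Qed.

Lemma leq_expn (m a b : nat) : (a <= b -> a ^ m <= b ^ m)%N.
Proof. by case: m => // m; rewrite leq_exp2r. Qed.

Lemma leq_ffact_exp (n j : nat) : (n ^_ j <= n ^ j)%N.
Proof.
elim: j n => [|j IH] n //; rewrite ffactnS expnS leq_mul // (leq_trans (IH _)) //.
by rewrite leq_expn // leq_pred.
Qed.

(** With [j = n %/ 4], fourth powers are compared: the powers of [K * n] and [e] give at most
    [(K * n) ^ (2 * n) <= j ^ (3 * n)], and the fourth power of j! is at most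
    [j ^ (4 * j) <= j ^ n]. *)
Lemma exp_mul_fact_le (K n c e : nat) :
  (0 < K -> 512 * K ^ 2 <= n -> 2 * c <= n -> e ^ 2 <= K * n ->
   (K * n) ^ c * e ^ (n - 2 * c) * (n %/ 4)`! <= (n %/ 4) ^ n)%N.
Proof.
move=> K0 Kn cn eK; set j := (n %/ 4)%N.
have n512 : (512 <= n)%N by apply: leq_trans Kn; rewrite leq_pmulr // expn_gt0 K0.
have j4 : (4 * j <= n)%N by rewrite mulnC leq_trunc_div.
have j8 : (n <= 8 * j)%N by rewrite /j; lia.
have j0 : (0 < j)%N by lia.
have eA : (((K * n) ^ c * e ^ (n - 2 * c)) ^ 2 <= (K * n) ^ n)%N.
  rewrite expnMn -expnM [(c * 2)%N]mulnC -expnM [((_ - _) * 2)%N]mulnC [(e ^ _)%N]expnM.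
  by rewrite -{4}(subnKC cn) expnD leq_mul // leq_expn.
(* The constant 512 is [8 ^ 3]: the hypothesis gives [512 * (K * n) ^ 2 <= n ^ 3], and
   [n <= 8 * j]. *)
have jA : ((K * n) ^ 2 <= j ^ 3)%N.
  rewrite -(@leq_pmul2l (8 ^ 3)) //; apply: (@leq_trans (n ^ 3)).
    by rewrite expnMn mulnA [(8 ^ 3)%N](_ : _ = 512)%N // [leqRHS]expnS leq_mul.
  by rewrite -expnMn leq_exp2r.
rewrite -(@leq_exp2r _ _ 4) // expnMn [4%N](_ : _ = 2 * 2)%N //.
rewrite [X in (X * _ <= _)%N]expnM.
apply: (@leq_trans ((j ^ 3) ^ n * j ^ n)%N); last first.
  by rewrite -!expnM -expnD leq_pexp2l //; lia.
apply: leq_mul.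
  apply: (@leq_trans (((K * n) ^ n) ^ 2)%N); first by rewrite leq_exp2r.
  by rewrite -expnM [(n * 2)%N]mulnC expnM leq_expn.
apply: (@leq_trans ((j ^ j) ^ (2 * 2))%N).
  by rewrite leq_exp2r // -ffactnn leq_ffact_exp.
by rewrite -expnM leq_pexp2l //; lia.
Qed.

(* Arguments e with e ^ 2 >= K n contribute at most the right-hand side; for the
   others a single term, e = n / 4, of the right-hand side is already larger. *)
Lemma dobinski_drop_exp (R : realFieldType) (K n c E : nat) :
  (0 < K)%N -> (512 * K ^ 2 <= n)%N -> (2 * c <= n)%N -> (n < E)%N ->
  ((K * n) ^ c)%:R * dobinski R E (fun e => e ^ (n - 2 * c))%N
    <= 4 * dobinski R E (fun e => e ^ n)%N.
Proof.
move=> K0 Kn cn nE; set D := dobinski R E (fun e => e ^ n)%N.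
have D1 : ((n %/ 4) ^ n)%:R / (n %/ 4)`!%:R <= D.
  have jE : (n %/ 4 < E)%N by apply: leq_ltn_trans nE; exact: leq_div.
  rewrite /D /dobinski (bigD1 (Ordinal jE)) //= lerDl.
  by apply: sumr_ge0 => e _; rewrite divr_ge0.
have D0 : 0 <= D by exact: dobinski_ge0.
(* Each numerator is bounded by [e ^ n + D]; after division by e! and summation this gives at most
   [D + 3 * D]. *)
apply: (@le_trans _ _ (D + D * \sum_(e < E) (e`!%:R)^-1)); last first.
  have : D * \sum_(e < E) (e`!%:R)^-1 <= D * 3.
    by rewrite ler_wpM2l // sum_inv_fact_le3.
  lra.
rewrite [leLHS]mulr_sumr [X in D + X]mulr_sumr {1}/D /dobinski -big_split /=.
apply: ler_sum => e _; rewrite mulrA -mulrDl ler_wpM2r ?invr_ge0 // -natrM.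
have [eK|Ke] := leqP (e ^ 2) (K * n).
  apply: (@le_trans _ _ D); last by rewrite lerDr.
  apply: le_trans D1; rewrite ler_pdivlMr ?ltr0n ?fact_gt0 // -natrM ler_nat.
  exact: exp_mul_fact_le.
rewrite -[leLHS]addr0 lerD // ler_nat -[X in (_ <= _ ^ X)%N](subnKC cn) expnD expnM.
by rewrite leq_mul // leq_expn // ltnW.
Qed.

(** After multiplication by c! the left side is at most [(a * c) ^ c], and [c ^ c <= (2 * c) ^_ c],
    which is c! times a binomial coefficient bounded by [2 ^ (2 * c)]. *)
Lemma bin_mul_le (a n c : nat) : (a <= n -> 'C(a * c, c) <= (4 * n) ^ c)%N.
Proof.
move=> an; rewrite -(@leq_pmul2r (c`!)) ?fact_gt0 // bin_ffact.
apply: leq_trans (leq_ffact_exp _ _) _; rewrite !expnMn [(4 ^ c * _)%N]mulnC -mulnA.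
apply: leq_mul; first exact: leq_expn.
have -> : (4 ^ c = 2 ^ (2 * c))%N by rewrite expnM.
apply: (@leq_trans ((2 * c) ^_ c)).
  rewrite ffact_prod -[X in (_ ^ X)%N]card_ord -prod_nat_const.
  by apply: leq_prod => i _; have := ltn_ord i; lia.
rewrite -bin_ffact leq_mul2r -[2%N in leqRHS]/(1 + 1)%N expnDn.
have cc : (c < (2 * c).+1)%N by lia.
by rewrite (bigD1 (Ordinal cc)) //= !exp1n !muln1 leq_addr orbT.
Qed.

(** Removing [2 * q v] from each degree splits d(v)! into [d v ^_ (2 * q v)], at most
    [k ^ (2 * q v)], and the factorial of the remaining degree, which turns the binomial of the
    simple part into a falling factorial. *)
Lemma mult_systems_le_halves (R : realFieldType) (V : finType) (B k E : nat)
    (d : V -> nat) :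
  (forall v, d v <= k)%N -> (\sum_v d v < E)%N ->
  #|mult_systems B d|%:R * (\prod_v (d v)`!)%:R <=
    \sum_(nu : {ffun {set V} -> 'I_B} | (nu set0 == 0 :> nat)%N &&
            [forall v, 2 * mult_deg nu v <= d v]%N)
       (k ^ (2 * \sum_v mult_deg nu v))%:R *
       dobinski R E (fun e => e ^ (\sum_v d v - 2 * \sum_v mult_deg nu v))%N.
Proof.
move=> dk dE.
apply: (@le_trans _ _ (\sum_(nu : {ffun {set V} -> 'I_B} | (nu set0 == 0 :> nat)%N &&
            [forall v, 2 * mult_deg nu v <= d v]%N)
       #|simple_systems (fun v => d v - 2 * mult_deg nu v)%N|%:R
       * (\prod_v (d v)`!)%:R)).
  by rewrite -mulr_suml -natr_sum ler_wpM2r // ler_nat mult_systems_halve.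
apply: ler_sum => nu /andP[_ /forallP nud].
set q := mult_deg nu; set d' := fun v => (d v - 2 * q v)%N.
have d'E : (\sum_v d v - 2 * \sum_v q v = \sum_v d' v)%N.
  by rewrite big_distrr /= -sumnB // => v _; exact: nud.
have d'd : (\sum_v d' v < E)%N.
  by apply: leq_ltn_trans dE; apply: leq_sum => v _; rewrite leq_subr.
rewrite d'E.
apply: le_trans (ler_wpM2r _ (simple_systems_le_dobinski R d'd)) _ => //.
rewrite mulrC -dobinskiZ -dobinskiZ; apply: le_dobinski => e.
have -> : (\prod_v (d v)`! = (\prod_v (d v) ^_ (2 * q v)) * \prod_v (d' v)`!)%N.
  by rewrite -big_split; apply: eq_bigr => v _; rewrite /= ffact_fact.
rewrite -mulnA prod_fact_bin; apply: leq_mul.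
  rewrite big_distrr /= expn_sum; apply: leq_prod => v _.
  by apply: leq_trans (leq_ffact_exp _ _) _; exact: leq_expn.
by rewrite expn_sum; apply: leq_prod => v _; exact: leq_ffact_exp.
Qed.

(** Sorted by the weight [c] of the doubled part, the contributions decay like [2^-1 ^+ c]. The
    constant 24 is the product of 2 from the geometric series, 4 from [dobinski_drop_exp] and 3 from
    Dobinski's formula. *)
Lemma mult_systems_upper (R : realFieldType) (V : finType) (B k n : nat)
    (d : V -> nat) :
  (0 < k)%N -> (forall v, 0 < d v <= k)%N -> (\sum_v d v = n)%N ->
  (512 * (8 * k ^ 2) ^ 2 <= n)%N ->
  #|mult_systems B d|%:R * (\prod_v (d v)`!)%:R <=
    24 * #|[set P | partition P [set: 'I_n]]|%:R :> R.
Proof.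
move=> k0 dk dn kn.
have Vn : (#|V| <= n)%N.
  by rewrite -sum1_card -dn; apply: leq_sum => v _; case/andP: (dk v).
have dE : (\sum_v d v < n.+1)%N by rewrite dn.
have dk' v : (d v <= k)%N by case/andP: (dk v).
apply: le_trans (mult_systems_le_halves R B dk' dE) _; rewrite dn.
set D := dobinski R n.+1.
pose wt (nu : {ffun {set V} -> 'I_B}) := (\sum_v mult_deg nu v)%N.
set P := (X in \sum_(nu | X nu) _).
have wtP nu : P nu -> (2 * wt nu <= n)%N.
  by move=> /andP[_ /forallP nud]; rewrite -dn /wt big_distrr leq_sum.
have wt_lt nu : P nu -> (wt nu < n.+1)%N.
  by move=> /wtP wn; rewrite ltnS (leq_trans _ wn) ?leq_pmull.
have Dn : D (fun e => e ^ n)%N <= 3 * #|[set P | partition P [set: 'I_n]]|%:R.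
  by have := dobinski_le_partitions R 'I_n n.+1; rewrite card_ord.
rewrite (partition_big (fun nu => inord (wt nu) : 'I_n.+1) xpredT) //=.
apply: (@le_trans _ _ (\sum_(c < n.+1) 2^-1 ^+ c * (4 * D (fun e => e ^ n)%N))).
  apply: ler_sum => c _; have [cn|cn] := leqP (2 * c) n; last first.
    rewrite big_pred0 ?mulr_ge0 ?exprn_ge0 ?invr_ge0 ?dobinski_ge0 //.
    move=> nu; apply/negP => /andP[/wtP nun /eqP nuc].
    move: cn; rewrite -nuc inordK; last by rewrite ltnS (leq_trans _ nun) ?leq_pmull.
    by rewrite ltnNge nun.
  apply: (@le_trans _ _ ('C(#|V| * c, c)%:R *
      ((k ^ (2 * c))%:R * D (fun e => e ^ (n - 2 * c))%N))).
    apply: (@le_trans _ _ (\sum_(nu : {ffun {set V} -> 'I_B} | (nu set0 == 0 :> nat)%N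
        && (wt nu == c)) (k ^ (2 * c))%:R * D (fun e => e ^ (n - 2 * c))%N)).
      rewrite [leLHS]big_mkcond [leRHS]big_mkcond; apply: ler_sum => nu _ /=.
      case: ifP => [/andP[nuP /eqP nuc]|_]; last first.
        by case: ifP => // _; rewrite mulr_ge0 ?dobinski_ge0.
      have <- : wt nu = c.
        by rewrite -nuc inordK // wt_lt.
      by case/andP: nuP => -> _; rewrite eqxx.
    rewrite sumr_const -[leLHS]mulr_natl ler_wpM2r ?mulr_ge0 ?dobinski_ge0 // ler_nat.
    by apply: leq_trans (card_mult_weight V B c); rewrite cardsE.
  (* The choice [K = 8 * k ^ 2] splits [(K * n) ^ c] into [(4 * n) ^ c] for the choice of [nu],
     [(k ^ 2) ^ c] for the degrees, and a spare [2 ^ c] that makes the sum over [c] converge. *)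
  have K0 : (0 < 8 * k ^ 2)%N by rewrite muln_gt0 expn_gt0 k0.
  have := dobinski_drop_exp R K0 kn cn (ltnSn n); rewrite -/D => h.
  rewrite exprVn ler_pdivlMl ?exprn_gt0 //; apply: le_trans h.
  rewrite !mulrA ler_wpM2r ?dobinski_ge0 // -natrX -!natrM ler_nat.
  rewrite expnM mulnA -[leqRHS](_ : 2 ^ c * (4 * n) ^ c * (k ^ 2) ^ c = _)%N; last first.
    by rewrite -!expnMn; congr (_ ^ _)%N; ring.
  by rewrite leq_mul2r leq_mul2l bin_mul_le ?orbT.
rewrite -mulr_suml.
have h2 : \sum_(c < n.+1) (2^-1 : R) ^+ c <= 2.
  suff -> : \sum_(c < n.+1) (2^-1 : R) ^+ c = 2 - 2^-1 ^+ n.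
    by rewrite gerBl exprn_ge0 // invr_ge0.
  elim: (n) => [|m IH]; first by rewrite big_ord1 !expr0; lra.
  rewrite big_ord_recr /= IH [_ ^+ m.+1]exprS; set y := _ ^+ m; lra.
have D0 : 0 <= D (fun e => e ^ n)%N by exact: dobinski_ge0.
have := ler_wpM2r (mulr_ge0 (ler0n R 4) D0) h2.
by set x := (_ * (4 * _)); set y := #|_|%:R in Dn *; lra.
Qed.

(** As [d v <= k], every factor of [e ^_ (d v)] is at least [e.+1 - k]. *)
Lemma mult_systems_lower (R : realFieldType) (V : finType) (B k E : nat)
    (d : V -> nat) :
  (forall v, 0 < d v <= k)%N -> (k < B)%N ->
  dobinski R E (fun e => (e.+1 - k) ^ \sum_v d v)%N <=
    3 * (#|mult_systems B d|%:R * (\prod_v (d v)`!)%:R).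
Proof.
move=> dk kB; rewrite mulrA.
have B0 : (0 < B)%N by apply: leq_ltn_trans kB.
have dB v : (d v < B)%N by apply: leq_ltn_trans kB; case/andP: (dk v).
apply: le_trans (ler_wpM2r _ (dobinski_le_mult_systems R E B0 dB)) => //.
rewrite [leRHS]mulrC -dobinskiZ; apply: le_dobinski => e.
rewrite prod_fact_bin expn_sum; apply: leq_prod => v _; case/andP: (dk v) => _ dvk.
rewrite ffact_prod -[X in (_ ^ X <= _)%N]card_ord -prod_nat_const.
by apply: leq_prod => i _; have := ltn_ord i; lia.
Qed.

(** * Compositions with bounded parts *)

From mathcomp Require Import all_classical all_reals all_analysis.

(** The recursion on the first part is not structural in [n], hence [fuel]; any value from [n] on
    gives all compositions. *)
Fixpoint compositions (k fuel n : nat) : seq (seq nat) :=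
  if n is 0 then [:: [::]]
  else if fuel is f.+1 then
    [seq i :: ds | i <- iota 1 (minn k n), ds <- compositions k f (n - i)]
  else [::].

Lemma mem_compositions (k f n : nat) (ds : seq nat) :
  (n <= f)%N ->
  (ds \in compositions k f n) = all (fun i => 0 < i <= k)%N ds && (sumn ds == n).
Proof.
elim: f n ds => [|f IH] [|n] ds //= nf; try by
  rewrite inE; case: ds => [|[|i] ds] //=; rewrite ?andbF.
apply/allpairsPdep/idP => [[i [es [+ + ->]]]|].
  rewrite mem_iota => /andP[i0 ik]; rewrite IH; last by lia.
  by move=> /andP[/= -> /eqP ->] /=; lia.
case: ds => [|i ds] //= /andP[/andP[/andP[i0 ik] dsk] /eqP ids].
exists i, ds; split=> //; first by rewrite mem_iota; lia.
by rewrite IH; [rewrite dsk; lia|lia].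
Qed.

Lemma uniq_compositions (k f n : nat) : uniq (compositions k f n).
Proof.
elim: f n => [|f IH] [|n] //=.
apply: allpairs_uniq_dep; rewrite ?iota_uniq // => -[i ds] [j es] _ _ /= [-> ->].
by [].
Qed.

Definition inv_fact_weight (R : fieldType) (ds : seq nat) : R :=
  \prod_(d <- ds) (d`!%:R)^-1.

Lemma sum_compositionsS (R : fieldType) (k f n : nat) :
  \sum_(ds <- compositions k f.+1 n.+1) inv_fact_weight R ds =
  \sum_(1 <= i < (minn k n.+1).+1) (i`!%:R)^-1 *
    \sum_(ds <- compositions k f (n.+1 - i)) inv_fact_weight R ds.
Proof.
rewrite [compositions _ _ _]/= big_allpairs_dep /index_iota subSS subn0.
apply: eq_bigr => i _; rewrite mulr_sumr; apply: eq_bigr => ds _.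
by rewrite /inv_fact_weight big_cons.
Qed.

Lemma inv_fact_weight_ge0 (R : realFieldType) (ds : seq nat) :
  0 <= inv_fact_weight R ds.
Proof. by apply: prodr_ge0 => i _; rewrite invr_ge0. Qed.

Section Alpha.
Context (R : realType) (k : nat) (alpha : R).

Lemma horner_alpha_poly (x : R) :
  (alpha_poly R k).[x] = \sum_(1 <= i < k.+1) (i`!%:R)^-1 * x ^+ i - 1.
Proof.
rewrite /alpha_poly hornerD hornerN hornerC horner_sum; congr (_ - 1).
by apply: eq_bigr => i _; rewrite hornerZ hornerXn.
Qed.

Hypotheses (a0 : 0 < alpha) (a1 : alpha <= 1) (ra : root (alpha_poly R k) alpha).

Let sumE : \sum_(1 <= i < k.+1) (i`!%:R)^-1 * alpha ^+ i = 1.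
Proof. by apply/eqP; move: ra; rewrite rootE horner_alpha_poly subr_eq0. Qed.

Let exprVnB (n i : nat) : (i <= n)%N -> alpha^-1 ^+ (n - i) = alpha ^+ i * alpha^-1 ^+ n.
Proof.
move=> ni; rewrite -[in RHS](subnKC ni) exprD mulrA -exprMn mulfV ?gt_eqF //.
by rewrite expr1n mul1r.
Qed.

(** The powers of [alpha^-1] solve the recurrence with all parts up to [k], by the equation for
    [alpha]; limiting the parts to [n] can only decrease the sum. *)
Lemma sum_compositions_le (f n : nat) : (n <= f)%N ->
  \sum_(ds <- compositions k f n) inv_fact_weight R ds <= alpha^-1 ^+ n.
Proof.
elim: f n => [|f IH] [|n] // nf; rewrite ?big_seq1 /inv_fact_weight ?big_nil //.
rewrite sum_compositionsS.
apply: (@le_trans _ _ (\sum_(1 <= i < (minn k n.+1).+1)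
    (i`!%:R)^-1 * alpha ^+ i * alpha^-1 ^+ n.+1)).
  apply: ler_sum_nat => i /andP[i0 ik].
  rewrite -mulrA ler_wpM2l ?invr_ge0 // -exprVnB; last by lia.
  by apply: IH; lia.
rewrite -mulr_suml; apply: ler_piMl; first by rewrite exprn_ge0 // invr_ge0 ltW.
rewrite -[leRHS]sumE [leRHS](big_cat_nat _ (n := (minn k n.+1).+1)) //=; last by rewrite ltnS geq_minl.
rewrite lerDl; apply: sumr_ge0 => i _.
by rewrite mulr_ge0 ?invr_ge0 // exprn_ge0 // ltW.
Qed.

(** The composition into ones alone has weight 1. *)
Lemma sum_compositions_ge1 (f n : nat) : (0 < k)%N -> (n <= f)%N ->
  1 <= \sum_(ds <- compositions k f n) inv_fact_weight R ds.
Proof.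
move=> k0; elim: f n => [|f IH] [|n] // nf; rewrite ?big_seq1 /inv_fact_weight ?big_nil //.
rewrite sum_compositionsS big_ltn ?ltnS; last by lia.
rewrite (_ : 1`! = 1)%N //. rewrite subn1 invr1 mul1r.
apply: le_trans (IH n nf) _; rewrite lerDl; apply: sumr_ge0 => i _.
by rewrite mulr_ge0 ?invr_ge0 // sumr_ge0 // => ds _; exact: inv_fact_weight_ge0.
Qed.

(** For [n <= k] the left side is [alpha ^+ (k - n)], at most 1. For larger [n] every part up to [k]
    is available, so the recurrence preserves the bound exactly. *)
Lemma sum_compositions_ge (f n : nat) : (0 < k)%N -> (n <= f)%N ->
  alpha ^+ k * alpha^-1 ^+ n <= \sum_(ds <- compositions k f n) inv_fact_weight R ds.
Proof.
move=> k0; elim: f n => [|f IH] n nf; have [nk|kn] := leqP n k; try by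
  apply: le_trans (sum_compositions_ge1 k0 nf);
  rewrite -[k](subnK nk) exprD -mulrA -exprMn mulfV ?gt_eqF // expr1n mulr1
    exprn_ile1 // ltW.
  by move: (leq_trans kn nf).
case: n nf kn => // n nf kn; rewrite sum_compositionsS (minn_idPl (ltnW kn)).
rewrite -[leLHS]mul1r -[X in X * _ <= _]sumE mulr_suml; apply: ler_sum_nat => i /andP[i0 ik].
rewrite -mulrA ler_wpM2l ?invr_ge0 // mulrCA -exprVnB; last by lia.
by apply: IH; lia.
Qed.

End Alpha.

(** The polynomial is strictly increasing on the nonnegative reals thanks to its linear term, equals
    -1 at 0, and is nonnegative at 1, where the linear term already cancels the constant. *)
Lemma unique_alpha (R : realType) (k : nat) : (0 < k)%N ->
  exists alpha : R, unique (fun x : R => 0 < x <= 1 /\ root (alpha_poly R k) x) alpha.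
Proof.
move=> k0; set p := alpha_poly R k.
have p_incr (x y : R) : 0 <= x -> x < y -> p.[x] < p.[y].
  move=> x0 xy; rewrite !horner_alpha_poly ltrD2r big_ltn ?ltnS // [ltRHS]big_ltn ?ltnS //.
  rewrite ltr_leD //; first by rewrite (_ : 1`! = 1)%N // invr1 !mul1r !expr1.
  apply: ler_sum => i _; rewrite ler_wpM2l ?invr_ge0 // lerXn2r ?nnegrE //.
    exact: le_trans (ltW xy).
  exact: ltW.
have p0 : p.[0] = -1.
  rewrite horner_alpha_poly big_nat big1 ?sub0r // => i /andP[i0 _].
  by rewrite expr0n gtn_eqF // mulr0.
have p1 : 0 <= p.[1].
  rewrite horner_alpha_poly big_ltn ?ltnS // (_ : 1`! = 1)%N // invr1 expr1n mulr1 addrAC subrr add0r.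
  by apply: sumr_ge0 => i _; rewrite expr1n mulr1 invr_ge0.
have [|alpha /andP[a0 a1] ra] := @poly_ivt R p 0 1 ler01.
  by rewrite p0 p1 andbT lerN10.
have apos : 0 < alpha.
  rewrite lt_def a0 andbT; apply: contraTneq ra => ->.
  by rewrite rootE p0 oppr_eq0 oner_eq0.
exists alpha; split=> [|x [/andP[x0 x1] rx]]; first by rewrite apos a1.
move: ra rx; rewrite !rootE => /eqP pa /eqP px.
have [ax|xa|//] := ltgtP alpha x.
  by have := p_incr _ _ (ltW apos) ax; rewrite pa px ltxx.
by have := p_incr _ _ (ltW x0) xa; rewrite pa px ltxx.
Qed.

(** * The bulk of the Dobinski sum *)

(* (1 + 1/j)^n <= exp (n / j) <= sqrt n, while 2 sqrt n <= 4 n / ln n <= j. *)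
Lemma dobinski_term_halves (R : realType) (n j : nat) :
  (1 < n)%N -> 4 * n%:R / ln (n%:R : R) <= j%:R ->
  2 * ((j.+1 ^ n)%:R / j.+1`!%:R) <= (j ^ n)%:R / j`!%:R :> R.
Proof.
move=> n1; have n0 : 0 < (n%:R : R) by rewrite ltr0n; lia.
have l0 : 0 < ln (n%:R : R) by rewrite ln_gt0 // ltr1n.
pose s : R := expR (ln n%:R / 2).
have s0 : 0 < s by exact: expR_gt0.
have ss : s * s = n%:R by rewrite -expRD -splitr lnK // posrE.
have ls : ln (n%:R : R) <= 2 * s.
  have := expR_ge1Dx (ln (n%:R : R) / 2); rewrite -/s.
  lra.
rewrite ler_pdivrMr // => jl.
have j0 : 0 < (j%:R : R).
  have : 0 < j%:R * ln (n%:R : R) by apply: lt_le_trans jl; rewrite mulr_gt0.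
  by rewrite pmulr_lgt0.
have sj : 2 * s <= j%:R.
  have : 4 * (s * s) <= j%:R * (2 * s).
    by rewrite ss (le_trans jl) // ler_wpM2l // ltW.
  rewrite mulrA mulrA ler_pM2r //; lra.
have powE : (j.+1 ^ n)%:R <= s * (j ^ n)%:R :> R.
  rewrite !natrX -ler_pdivrMr ?exprn_gt0 // -expr_div_n.
  have -> : j.+1%:R / j%:R = 1 + j%:R^-1 :> R.
    by rewrite -natr1 mulrDl mulfV ?gt_eqF // mul1r.
  apply: (@le_trans _ _ (expR (j%:R^-1) ^+ n)).
    by rewrite lerXn2r ?nnegrE ?expR_ge0 ?addr_ge0 ?invr_ge0 ?expR_ge1Dx // ltW.
  rewrite -expRM_natl ler_expR ler_pdivrMr //.
  by move: jl n0; lra.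
rewrite factS natrM invfM !mulrA ler_wpM2r ?invr_ge0 //.
rewrite ler_pdivrMr ?ltr0n //.
apply: (@le_trans _ _ (2 * (s * (j ^ n)%:R))); first by rewrite ler_wpM2l.
rewrite mulrA mulrC ler_wpM2l //; apply: le_trans sj _.
by rewrite ler_nat.
Qed.

(** From [J] on the terms at least halve, so the tail after the term at [J] is bounded by that
    term. *)
Lemma dobinski_truncate (R : realType) (n J E : nat) :
  (1 < n)%N -> 4 * n%:R / ln (n%:R : R) <= J%:R ->
  dobinski R E (fun e => e ^ n)%N <= 2 * dobinski R J.+1 (fun e => e ^ n)%N.
Proof.
move=> n1 nJ; set t := fun e : nat => (e ^ n)%:R / e`!%:R : R.
have t0 e : 0 <= t e by rewrite divr_ge0.
have dS F : dobinski R F.+1 (fun e => e ^ n)%N = dobinski R F (fun e => e ^ n)%N + t F.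
  by rewrite /dobinski big_ord_recr.
have [EJ|JE] := leqP E J.+1.
  rewrite -(subnKC EJ) /dobinski big_split_ord /= mulrDr.
  have h1 : 0 <= \sum_(i < E) t i by exact: sumr_ge0.
  have h2 : 0 <= \sum_(i < J.+1 - E) t (E + i)%N by exact: sumr_ge0.
  by move: h1 h2; rewrite /t; lra.
(* Counting the last term twice makes the bound inductive: twice the next term is at most the last
   one. *)
suff : dobinski R E (fun e => e ^ n)%N + t E.-1 <= 2 * dobinski R J.+1 (fun e => e ^ n)%N.
  by apply: le_trans; rewrite lerDl.
rewrite -(subnKC JE); elim: (E - J.+2)%N => [|m IH].
  rewrite addn0 /= dS; have := dobinski_term_halves n1 nJ; rewrite -/(t _) -/(t _).
  have := dS J; have := dobinski_ge0 R J (fun e => e ^ n)%N; lra.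
rewrite addnS /= dS; apply: le_trans IH; rewrite -addrA lerD2l.
have Jm : 4 * n%:R / ln (n%:R : R) <= (J.+2 + m).-1%:R.
  by apply: le_trans nJ _; rewrite ler_nat; lia.
by have := dobinski_term_halves n1 Jm; rewrite -/(t _) -/(t _) addSn /=; lra.
Qed.

(** Substituting [e = j + k - 1] replaces j! by (j + k - 1)!, larger by a product of [k - 1]
    factors, each at most [J + k]. With [J] of order n / ln n this is the source of the factor lost
    in the lower bound. *)
Lemma dobinski_shift (R : realFieldType) (n k J : nat) :
  (0 < k)%N ->
  dobinski R J.+1 (fun e => e ^ n)%N <=
    ((J + k) ^ (k - 1))%:R * dobinski R (k.-1 + J.+1) (fun e => (e.+1 - k) ^ n)%N.
Proof.
move=> k0; rewrite -dobinskiZ /dobinski big_split_ord /=.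
apply: ler_wpDl; first by apply: sumr_ge0 => i _; rewrite divr_ge0.
apply: ler_sum => j _; rewrite ler_pdivrMr ?ltr0n ?fact_gt0 // mulrAC.
rewrite ler_pdivlMr ?ltr0n ?fact_gt0 // -!natrM ler_nat.
have -> : ((k.-1 + j).+1 - k = j)%N by lia.
rewrite -(@ffact_fact (k.-1 + j) k.-1) ?leq_addr // addKn mulnCA mulnA leq_mul2r.
rewrite leq_mul2r subn1; apply/orP; right; apply/orP; right.
apply: leq_trans (leq_ffact_exp _ _) _; apply: leq_expn.
by have := ltn_ord j; lia.
Qed.

(** Truncation costs 2 and the comparison with multisets 3. The integer [J] exceeds [x] by at most
    1, while [q * x = 4] and [q <= 1], so [q * (J + k)] is at most [5 + k]. *)
Lemma mult_systems_ln_lower (R : realType) (V : finType) (B k n : nat)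
    (d : V -> nat) :
  (0 < k < B)%N -> (forall v, 0 < d v <= k)%N -> (\sum_v d v = n)%N -> (1 < n)%N ->
  (ln n%:R / n%:R) ^+ (k - 1) * (bell n)%:R <=
    6 * (5 + k%:R) ^+ (k - 1) * (#|mult_systems B d|%:R * (\prod_v (d v)`!)%:R) :> R.
Proof.
move=> /andP[k0 kB] dk dn n1.
have n0 : 0 < (n%:R : R) by rewrite ltr0n; lia.
have l0 : 0 < ln (n%:R : R) by rewrite ln_gt0 // ltr1n.
set x : R := 4 * n%:R / ln n%:R; pose J := (Num.truncn x).+1.
have x0 : 0 <= x by rewrite divr_ge0 ?mulr_ge0 // ltW.
have /andP[xJ Jx] := truncn_itv x0; rewrite -/J in Jx.
have J1 : J%:R <= x + 1 by rewrite /J -natr1 lerD2r.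
set b := (bell n)%:R; set W := _ * (\prod_v _)%:R.
have W0 : 0 <= W by rewrite mulr_ge0.
set q := ln n%:R / n%:R : R.
have q0 : 0 <= q by rewrite divr_ge0 // ltW.
have bD : b <= 2 * dobinski R J.+1 (fun e => e ^ n)%N.
  apply: le_trans (dobinski_truncate n.+1 n1 (ltW Jx)).
  by have := partitions_le_dobinski R (V := 'I_n) (E := n.+1); rewrite card_ord; apply.
have DW : dobinski R J.+1 (fun e => e ^ n)%N <= ((J + k) ^ (k - 1))%:R * (3 * W).
  apply: le_trans (dobinski_shift R n J k0) _; rewrite ler_wpM2l //.
  by rewrite -dn; exact: mult_systems_lower.
have qJ : q ^+ (k - 1) * ((J + k) ^ (k - 1))%:R <= (5 + k%:R) ^+ (k - 1).
  rewrite natrX -exprMn; apply: lerXn2r; rewrite ?nnegrE ?(mulr_ge0 q0) ?addr_ge0 //.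
  have qx : q * x = 4 by rewrite /q /x; field; rewrite !gt_eqF.
  have q1 : q <= 1.
    rewrite ler_pdivrMr // mul1r.
    by have := expR_ge1Dx (ln (n%:R : R)); rewrite lnK ?posrE //; lra.
  rewrite natrD; apply: (@le_trans _ _ (q * (x + 1 + k%:R))).
    by rewrite ler_wpM2l // lerD2r.
  rewrite -addrA mulrDr qx; have : q * (1 + k%:R) <= 1 * (1 + k%:R).
    by rewrite ler_wpM2r // addr_ge0.
  lra.
apply: (@le_trans _ _ (q ^+ (k - 1) * (2 * (((J + k) ^ (k - 1))%:R * (3 * W))))).
  rewrite ler_wpM2l ?exprn_ge0 //; apply: le_trans bD _.
  by rewrite ler_wpM2l.
have := ler_wpM2r (mulr_ge0 (ler0n R 6) W0) qJ.
set y := q ^+ _; set z := ((J + k) ^ _)%:R; set t := (5 + _) ^+ _; lra.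
Qed.

(** * Summation over all degree sequences *)

Import numFieldNormedType.Exports.
Local Open Scope classical_set_scope.
Local Open Scope ring_scope.

(** Each system is sorted under its degree sequence, which occurs exactly once in the list of
    compositions; [counted_systemsP] identifies each class. *)
Lemma card_systemsE (k n : nat) : (0 < n)%N ->
  card_systems k n =
  (\sum_(ds <- compositions k n n)
     #|@mult_systems 'I_(size ds) k.+1 (fun i => nth 0 ds i)|)%N.
Proof.
move=> n0; rewrite /card_systems; set F := fset_set _.
have FP H : H \in F -> counted_systems k n H.
  by rewrite in_fset_set ?inE //; exact: counted_systems_finite.
have dsF H : H \in F -> degree_seq H \in compositions k n n.
  move=> /FP /degree_seq_parts[dk dn].
  by rewrite mem_compositions // dk dn eqxx.
transitivity (\sum_(H <- F) \sum_(ds <- compositions k n n) (degree_seq H == ds))%N.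
  rewrite -sum1_size [LHS]big_seq [RHS]big_seq; apply: eq_bigr => H /dsF dsH.
  have := count_uniq_mem (degree_seq H) (uniq_compositions k n n).
  rewrite dsH /= -sum1_count big_mkcond => <-.
  by apply: eq_bigr => ds _; rewrite /= (eq_sym ds); case: (_ == _).
rewrite exchange_big /= big_seq [RHS]big_seq; apply: eq_bigr => ds.
rewrite mem_compositions // => /andP[dk /eqP dn].
rewrite cardE -(size_map (@system_of _ _)).
transitivity (size [seq H <- F | degree_seq H == ds]).
  rewrite size_filter -sum1_count [RHS]big_mkcond.
  by apply: eq_bigr => H _; case: eqP.
apply: perm_size; apply: uniq_perm => [||H].
- by rewrite filter_uniq ?fset_uniq.
- by rewrite map_inj_uniq ?enum_uniq //; exact: system_of_inj.
rewrite mem_filter; apply/andP/mapP => [[/eqP dH /FP HC]|[mu + HE]].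
  have [mu muP muH] := (counted_systemsP H n0 dk dn).1 (conj HC dH).
  by exists mu; rewrite ?mem_enum.
rewrite mem_enum => muP.
have [HC ->] : counted_systems k n H /\ degree_seq H = ds.
  by apply/(counted_systemsP H n0 dk dn); exists mu.
by rewrite in_fset_set ?inE //; exact: counted_systems_finite.
Qed.

(** Inserted as a factor 1, it turns bounds on the product of factorials times N(d) into bounds on
    N(d) weighted by [inv_fact_weight]. *)
Lemma prod_fact_weight (R : realFieldType) (ds : seq nat) :
  (\prod_(i < size ds) (nth 0%N ds i)`!)%:R * inv_fact_weight R ds = 1.
Proof.
rewrite natr_prod /inv_fact_weight (big_nth 0%N) big_mkord -big_split /= big1 // => i _.
by rewrite mulfV // pnatr_eq0 -lt0n fact_gt0.
Qed.

Lemma compositions_degrees (k n : nat) (ds : seq nat) :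
  ds \in compositions k n n ->
  (forall i : 'I_(size ds), 0 < nth 0 ds i <= k)%N /\
  (\sum_(i < size ds) nth 0 ds i = n)%N.
Proof.
rewrite mem_compositions // => /andP[/allP dk /eqP <-]; split.
  by move=> i; apply: dk; rewrite mem_nth.
by rewrite sumnE (big_nth 0%N) big_mkord.
Qed.

Lemma card_systems_upper (R : realType) (k n : nat) (alpha : R) :
  (0 < k)%N -> 0 < alpha -> alpha <= 1 -> root (alpha_poly R k) alpha ->
  (512 * (8 * k ^ 2) ^ 2 <= n)%N ->
  (card_systems k n)%:R <= 24 * (alpha^-1 ^+ n * (bell n)%:R).
Proof.
move=> k0 a0 a1 ra kn.
have n0 : (0 < n)%N by apply: leq_trans kn; rewrite muln_gt0 !expn_gt0 muln_gt0 expn_gt0 k0.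
rewrite card_systemsE // natr_sum.
apply: (@le_trans _ _ (\sum_(ds <- compositions k n n) 24 * (bell n)%:R * inv_fact_weight R ds)).
  rewrite big_seq [leRHS]big_seq; apply: ler_sum => ds /compositions_degrees[dk dn].
  rewrite -[leLHS]mulr1 -[X in _ * X <= _](prod_fact_weight R ds) mulrA.
  rewrite ler_wpM2r ?inv_fact_weight_ge0 //.
  exact: (mult_systems_upper R _ k0 dk dn kn).
rewrite -mulr_sumr -mulrA ler_wpM2l // mulrC ler_wpM2r //.
exact: sum_compositions_le.
Qed.

(** The division by [alpha ^+ k] compensates for the initial values in [sum_compositions_ge]. *)
Lemma card_systems_lower (R : realType) (k n : nat) (alpha : R) :
  (0 < k)%N -> 0 < alpha -> alpha <= 1 -> root (alpha_poly R k) alpha -> (1 < n)%N ->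
  (ln n%:R / n%:R) ^+ (k - 1) * alpha^-1 ^+ n * (bell n)%:R <=
    6 * (5 + k%:R) ^+ (k - 1) / alpha ^+ k * (card_systems k n)%:R.
Proof.
move=> k0 a0 a1 ra n1; have n0 : (0 < n)%N by apply: ltnW.
set q := _ ^+ _; set C := 6 * _.
have q0 : 0 <= q by rewrite exprn_ge0 // divr_ge0 // ln_ge0 // ler1n.
rewrite [leRHS]mulrAC ler_pdivlMr ?exprn_gt0 //.
apply: (@le_trans _ _ (q * (bell n)%:R *
    \sum_(ds <- compositions k n n) inv_fact_weight R ds)).
  have -> : q * alpha^-1 ^+ n * (bell n)%:R * alpha ^+ k =
            q * (bell n)%:R * (alpha ^+ k * alpha^-1 ^+ n) by ring.
  by rewrite ler_wpM2l ?mulr_ge0 //; exact: sum_compositions_ge.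
rewrite card_systemsE // natr_sum !mulr_sumr.
rewrite big_seq [leRHS]big_seq; apply: ler_sum => ds /compositions_degrees[dk dn].
rewrite -[leRHS]mulr1 -[X in _ <= _ * X](prod_fact_weight R ds) !mulrA.
rewrite ler_wpM2r ?inv_fact_weight_ge0 // -[leRHS]mulrA.
by apply: (mult_systems_ln_lower R _ dk dn n1); rewrite k0 /=.
Qed.

Theorem proposition2p8 (R : realType) (k : nat) (hk : (0 < k)%N) :
  exists2 alpha : R,
    unique (fun x : R => 0 < x <= 1 /\ root (alpha_poly R k) x) alpha &
    (fun n : nat => (ln n%:R / n%:R) ^+ (k - 1)%N * alpha^-1 ^+ n * (bell n)%:R : R)
      =O_\oo (fun n : nat => (card_systems k n)%:R : R)
    /\
    (fun n : nat => (card_systems k n)%:R : R)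
      =O_\oo (fun n : nat => alpha^-1 ^+ n * (bell n)%:R : R).
Proof.
have [alpha alphaP] := unique_alpha R hk.
have [[/andP[a0 a1] ra] _] := alphaP.
exists alpha => //; split; apply/eqO_exP.
  exists (6 * (5 + k%:R) ^+ (k - 1) / alpha ^+ k).
    by rewrite divr_gt0 ?exprn_gt0 ?mulr_gt0 ?exprn_gt0 ?ltr_wpDr.
  (* From [n = 2] on, ln n is positive. *)
  exists 2%N => // n /= n1; rewrite !ger0_norm ?card_systems_lower //.
  rewrite !mulr_ge0 ?exprn_ge0 ?invr_ge0 ?(ltW a0) //.
  by rewrite divr_ge0 // ln_ge0 // ler1n ltnW.
exists 24 => //; exists (512 * (8 * k ^ 2) ^ 2)%N => // n /= kn.
by rewrite !ger0_norm ?card_systems_upper // mulr_ge0 // exprn_ge0 // invr_ge0 ltW.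
Qed.
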